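(* Let $\beta\equiv\beta^{(4)}$ be a normalized nc sequence whose moment matrix $\mathcal{M}_2$ has rank 4, and suppose that the columns $\{\mathbf 1,\mathbb X,\mathbb Y,\mathbb X\mathbb Y\}$ form a basis of the column space of $\mathcal M_2$. Write $$\mathbb X^2=a_1\mathbf 1+b_1\mathbb X+c_1\mathbb Y+d_1\mathbb X\mathbb Y,\quad \mathbb Y\mathbb X=a_2\mathbf 1+b_2\mathbb X+c_2\mathbb Y+d_2\mathbb X\mathbb Y,\quad \mathbb Y^2=a_3\mathbf 1+b_3\mathbb X+c_3\mathbb Y+d_3\mathbb X\mathbb Y,$$ with $a_j,b_j,c_j,d_j\in\mathbb R$ for $j=1,2,3$. Then: (1) $d_1=d_3=0$ and $d_2=-1$. (2) $\beta$ admits a nc measure if and only if $\mathcal M_2$ has a flat extension to a moment matrix $\mathcal M_3$. (3) $\beta$ admits a nc measure if and only if $\mathcal M_2$ is positive semidefinite and $c_1=b_3=0$, $b_2=c_3$, $c_2=b_1$. (4) Suppose $\beta$ admits a nc measure. Then the minimal measure is of type $(0,1)$ with a unique (up to orthogonal equivalence) atom $(X,Y)$, a pair of real symmetric $2\times 2$ matrices, given by $$X=\begin{pmatrix}\sqrt{a_1+\frac{b_1^2}{4}}&0\\0&-\sqrt{a_1+\frac{b_1^2}{4}}\end{pmatrix}+\frac{b_1}{2}I_2,\qquad Y=\sqrt{a_3+\frac{c_3^2}{4}}\begin{pmatrix}\frac a2&\frac12\sqrt{4-a^2}\\ \frac12\sqrt{4-a^2}&-\frac a2\end{pmatrix}+\frac{c_3}{2}I_2,$$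 where $a=\dfrac{4a_2+2b_1c_3}{\sqrt{(4a_1+b_1^2)(4a_3+c_3^2)}}$ and $I_2$ is the $2\times2$ identity matrix.
   Context: Words are elements of the free monoid on noncommuting letters $X,Y$; $|w|$ is the length of $w$, $w^*$ its reverse, and $v,w$ are cyclically equivalent if $v$ is a cyclic permutation of $w$. A sequence $\beta\equiv\beta^{(4)}=(\beta_w)_{|w|\le4}$ is a family of real numbers with $\beta_v=\beta_w$ for cyclically equivalent $v,w$ and $\beta_w=\beta_{w^*}$. It is normalized if $\beta_1=1$, and a nc sequence if $\beta_{X^2Y^2}\ne\beta_{XYXY}$. Its moment matrix $\mathcal M_2$ is the symmetric $7\times7$ matrix with rows and columns indexed by $1,X,Y,X^2,XY,YX,Y^2$ and $(U,V)$ entry $\beta_{U^*V}$; the column indexed by $w$ is denoted $w(\mathbb X,\mathbb Y)$, and $\mathbf 1$ is the column indexed by the empty word. A representing measure for $\beta$ consists of finitely many pairs $(A_i,B_i)$ (atoms) of real symmetric $t_i\times t_i$ matrices ($t_i$ is the size) and numbers $\lambda_i>0$ (densities) with $\sum_i\lambda_i=1$ and $\beta_w=\sum_i\lambda_i\mathrm{Tr}(w(A_i,B_i))$ for all $|w|\le4$, where $\mathrm{Tr}(A)=\frac1t\mathrm{tr}(A)$ for $A\in\mathbb R^{t\times t}$. It is of type $(m_1,\dots,m_r)$ if it has exactly $m_i$ atoms of size $i$ and $m_r\neq0$. It is minimal if no other representing measure has smaller type, where types are compared first by $r$, then by $m_r$, then $m_{r-1}$, ..., then $m_1$. A nc measure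 exists for $\beta$ if $\beta$ has a minimal representing measure of type $(m_1,\dots,m_r)$ with $r>1$. Orthogonal equivalence means replacing an atom $(A,B)$ by $(UAU^t,UBU^t)$ with $U$ orthogonal. A moment matrix $\mathcal M_3$ is a matrix $(\beta_{U^*V})_{|U|,|V|\le3}$ for real numbers $(\beta_w)_{|w|\le6}$ invariant under cyclic equivalence and $*$. A flat extension of $\mathcal M_2$ to $\mathcal M_3$ is a moment matrix $\mathcal M_3=\begin{pmatrix}\mathcal M_2&B\\ B^t&C\end{pmatrix}$ with $\mathrm{rank}\,\mathcal M_3=\mathrm{rank}\,\mathcal M_2$.
   Formalization: In (2) the right side also requires M_2 to be positive semidefinite; without this, trace moments of diag(1,-1) and ((0,1),(-1,0)) give a flat extension with beta_{Y^2} = -1, so no measure exists. *)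

(* Defs.v *)
From mathcomp Require Import all_boot all_order all_algebra.
From mathcomp Require Import reals.

Set Implicit Arguments.
Unset Strict Implicit.
Unset Printing Implicit Defensive.

Import Order.TTheory GRing.Theory Num.Theory.
Local Open Scope ring_scope.

Inductive letter : Type := LX | LY.

(* The involution w^* on words is [rev]. *)
Definition word : Type := seq letter.

Definition cyclic_equiv (v w : word) : Prop := exists k : nat, v = rot k w.

(* A sequence beta^(d) is represented by a function on all words of which only
   the values at words of length at most d are ever used. *)
Definition tracial_seq (R : realType) (d : nat) (beta : word -> R) : Prop :=
  (forall v w : word, (size w <= d)%N -> cyclic_equiv v w -> beta v = beta w)
  /\ (forall w : word, (size w <= d)%N -> beta w = beta (rev w)).

Definition normalized (R : realType) (beta : word -> R) : Prop :=
  beta [::] = 1.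

Definition nc_seq (R : realType) (beta : word -> R) : Prop :=
  beta [:: LX; LX; LY; LY] <> beta [:: LX; LY; LX; LY].

Definition words2 : 7.-tuple word :=
  [tuple [::]; [:: LX]; [:: LY];
         [:: LX; LX]; [:: LX; LY]; [:: LY; LX]; [:: LY; LY]].

Definition words_deg3 : 8.-tuple word :=
  [tuple [:: LX; LX; LX]; [:: LX; LX; LY]; [:: LX; LY; LX]; [:: LX; LY; LY];
         [:: LY; LX; LX]; [:: LY; LX; LY]; [:: LY; LY; LX]; [:: LY; LY; LY]].

Definition words3 : (7 + 8).-tuple word := [tuple of words2 ++ words_deg3].

Definition moment_mx (R : realType) (n : nat) (W : n.-tuple word)
    (beta : word -> R) : 'M[R]_n :=
  \matrix_(i < n, j < n) beta (rev (tnth W i) ++ tnth W j).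

Definition M2 (R : realType) (beta : word -> R) : 'M[R]_7 :=
  moment_mx words2 beta.

Definition M3 (R : realType) (beta : word -> R) : 'M[R]_(7 + 8) :=
  moment_mx words3 beta.

(* w(X,Y), the column of M_2 indexed by w, for w of length at most 2. *)
Definition mcol (R : realType) (beta : word -> R) (w : word) : 'cV[R]_7 :=
  \col_(i < 7) beta (rev (tnth words2 i) ++ w).

Lemma mcolE (R : realType) (beta : word -> R) (j : 'I_7) :
  mcol beta (tnth words2 j) = col j (M2 beta).
Proof. by apply/colP => i; rewrite !mxE. Qed.

Definition colspace (R : realType) (m n : nat) (M : 'M[R]_(m, n)) :
    {vspace 'cV[R]_m} :=
  <<[seq col j M | j <- enum 'I_n]>>%VS.

Definition psd_mx (R : realType) (n : nat) (M : 'M[R]_n) : Prop :=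
  M^T = M /\ forall v : 'cV[R]_n, 0 <= (v^T *m M *m v) 0 0.

(* Positivity of M_3 is not part of this notion.  Without positivity of M_2 a
   flat extension does not give a measure: the normalized-trace moments of the
   pair A = diag(1,-1), B = ((0,1),(-1,0)) satisfy beta_{YY} = -1, yet M_2 has
   rank 4 and the moments up to order 6 form a flat extension M_3. *)
Definition has_flat_extension (R : realType) (beta : word -> R) : Prop :=
  exists (B : 'M[R]_(7, 8)) (C : 'M[R]_8) (gamma : word -> R),
    tracial_seq 6 gamma
    /\ M3 gamma = block_mx (M2 beta) B B^T C
    /\ \rank (M3 gamma) = \rank (M2 beta).

(* A pair of t x t matrices; t > 0 and symmetry are imposed in [is_atom]. *)
Record atom (R : Type) : Type :=
  Atom { asize : nat; atX : 'M[R]_asize; atY : 'M[R]_asize }.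

Definition is_atom (R : realType) (x : atom R) : bool :=
  [&& (0 < asize x)%N, (atX x)^T == atX x & (atY x)^T == atY x].

Definition eval_word (R : realType) (t : nat) (A B : 'M[R]_t) (w : word) :
    'M[R]_t :=
  \big[mulmx/1%:M]_(l <- w) (if l is LX then A else B).

Definition ntrace (R : realType) (t : nat) (A : 'M[R]_t) : R := \tr A / t%:R.

(* A finitely atomic measure is a list of (density, atom) pairs. *)
Definition measure (R : realType) : Type := seq (R * atom R).

Definition representing_measure (R : realType) (beta : word -> R)
    (mu : measure R) : Prop :=
  [/\ all (fun p => (0 < p.1) && is_atom p.2) mu,
      \sum_(p <- mu) p.1 = 1
    & forall w : word, (size w <= 4)%N ->
        beta w = \sum_(p <- mu)
                   p.1 * ntrace (eval_word (atX p.2) (atY p.2) w)].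

(* The type (m_1, ..., m_r), where r is the largest size of an atom. *)
Definition mtype (R : realType) (mu : measure R) : seq nat :=
  [seq count (fun p => asize p.2 == i) mu
     | i <- iota 1 (\max_(p <- mu) asize p.2)].

(* First by r, then by m_r, m_(r-1), ..., m_1. *)
Definition type_lt (s t : seq nat) : Prop :=
  (size s < size t)%N
  \/ (size s = size t
      /\ exists i : nat, (nth 0 s i < nth 0 t i)%N
           /\ forall j : nat, (i < j)%N -> nth 0%N s j = nth 0%N t j).

Definition minimal_measure (R : realType) (beta : word -> R)
    (mu : measure R) : Prop :=
  representing_measure beta mu
  /\ forall nu : measure R,
       representing_measure beta nu -> ~ type_lt (mtype nu) (mtype mu).

Definition has_nc_measure (R : realType) (beta : word -> R) : Prop :=
  exists mu : measure R, minimal_measure beta mu /\ (1 < size (mtype mu))%N.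

Definition orth_equiv (R : realType) (x y : atom R) : Prop :=
  exists U : 'M[R]_(asize x),
    U *m U^T = 1%:M /\ y = Atom (U *m atX x *m U^T) (U *m atY x *m U^T).

Definition mx2 (R : realType) (p q r s : R) : 'M[R]_2 :=
  \matrix_(i < 2, j < 2)
    if i == 0 then (if j == 0 then p else q) else (if j == 0 then r else s).

(* Main.v *)
Require Import Defs.
From mathcomp Require Import all_boot all_order all_algebra.
From mathcomp Require Import reals ring lra.

Import Order.TTheory GRing.Theory Num.Theory.
Local Open Scope ring_scope.

(* A measure or a flat extension extends beta to a tracial functional L of higher
   degree whose rows indexed by words of length 3 stay in the row space of M_2.
   Hence L(u r) = 0 for |u| <= 3 and each column relation r; since also
   L(u r l) = L(l u r) = 0 for a letter l, the moments L(u(lr - rl)) vanish, and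
   each condition appears there as a multiple of beta_XXYY - beta_XYXY.  Conversely, with X' = X - b_1/2 and
   Y' = Y - c_3/2 the relations become X'^2 = al, Y'^2 = ga, X'Y' + Y'X' = 2 de,
   where 2(al ga - de^2) = beta_XXYY - beta_XYXY.  As al L(Y') = de L(X') and
   ga L(X') = de L(Y'), both first moments vanish, so al, ga, de determine all
   moments; positivity gives al, ga > 0 and de^2 < al ga, which is what the 2 x 2
   atom needs.  Since beta_XXYY <> beta_XYXY excludes atoms of size 1 only,
   type (0,1) is the least possible. *)

(** Moves a moment to a chosen representative of its cyclic class, so that [lra] sees equal moments
    as the same unknown. *)
Ltac cyclic hb v w :=
  let H := fresh "H" in
  assert (H : cyclic_equiv v w) by
    (first [by exists 1%N | by exists 2%N | by exists 3%N | by exists 4%N]);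
  rewrite (proj1 hb v w isT H); clear H.

Ltac at_necklace k :=
  exists k; first [by exists 0%N | by exists 1%N | by exists 2%N | by exists 3%N].

Section Rank4.
Context {R : realType}.
Implicit Types (mu nu : measure R) (beta gamma : word -> R).

(** * Evaluation of words and moments of measures *)

Lemma eval_word_cat (t : nat) (A B : 'M[R]_t) (u v : word) :
  eval_word A B (u ++ v) = eval_word A B u *m eval_word A B v.
Proof.
rewrite /eval_word; elim: u => [|l u IH]; first by rewrite big_nil mul1mx.
by rewrite cat_cons !big_cons IH mulmxA.
Qed.

Lemma eval_word_rev (t : nat) (A B : 'M[R]_t) (w : word) :
  A^T = A -> B^T = B -> eval_word A B (rev w) = (eval_word A B w)^T.
Proof.
move=> hA hB; elim: w => [|l w IH]; first by rewrite /eval_word !big_nil trmx1.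
rewrite rev_cons -cats1 -[l :: w]cat1s !eval_word_cat trmx_mul IH.
by congr (_ *m _); rewrite /eval_word big_cons big_nil mulmx1; case: l.
Qed.

Lemma eval_word_cyclic (t : nat) (A B : 'M[R]_t) (v w : word) :
  cyclic_equiv v w -> \tr (eval_word A B v) = \tr (eval_word A B w).
Proof.
case=> k ->; rewrite /rot eval_word_cat mxtrace_mulC -eval_word_cat.
by rewrite cat_take_drop.
Qed.

(** Taken on words of every length: the values beyond degree 4 are what extends [beta]. *)
Definition measure_moment mu (w : word) : R :=
  \sum_(p <- mu) p.1 * ntrace (eval_word (atX p.2) (atY p.2) w).

Lemma measure_moment_cons (p : R * atom R) mu (w : word) :
  measure_moment (p :: mu) w
  = p.1 * ntrace (eval_word (atX p.2) (atY p.2) w) + measure_moment mu w.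
Proof. by rewrite /measure_moment big_cons. Qed.

Lemma measure_moment_tracial (d : nat) mu :
  all (fun p => (0 < p.1) && is_atom p.2) mu ->
  tracial_seq d (measure_moment mu).
Proof.
move=> hmu; split=> [v w _ hvw|w _].
  by apply: eq_bigr => p _; rewrite /ntrace (eval_word_cyclic _ _ _ _ _ hvw).
elim: mu hmu => [|p mu IH] /=; first by rewrite /measure_moment !big_nil.
case/andP=> /andP[_ /and3P[_ /eqP hA /eqP hB]] /IH hmu.
by rewrite !measure_moment_cons -hmu /ntrace eval_word_rev// mxtrace_tr.
Qed.

Lemma atom_tracial (d t : nat) (A B : 'M[R]_t) :
  A^T = A -> B^T = B -> tracial_seq d (fun w => ntrace (eval_word A B w)).
Proof.
move=> hA hB; split=> w => [v _ hvw|_].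
  by rewrite /ntrace (eval_word_cyclic _ _ _ _ _ hvw).
by rewrite /ntrace eval_word_rev// mxtrace_tr.
Qed.

(** * Moment matrices of measures as sums of Gram matrices *)

Definition word_vectors {t n : nat} (A B : 'M[R]_t) (W : n.-tuple word) :
    'M[R]_(t * t, n) :=
  \matrix_(k, j) mxvec (eval_word A B (tnth W j)) 0 k.

Lemma mxtrace_mxvec (t : nat) (A B : 'M[R]_t) :
  \tr (A *m B) = (mxvec A^T *m (mxvec B)^T) 0 0.
Proof.
rewrite mxE (reindex _ (curry_mxvec_bij _ _)) /= /mxtrace.
rewrite (eq_bigr (fun i => \sum_j A i j * B j i)); last by move=> i _; rewrite mxE.
rewrite exchange_big pair_bigA /=; apply: eq_bigr => -[i j] _ /=.
by rewrite [(mxvec B)^T _ _]mxE !mxvecE mxE.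
Qed.

Lemma ntrace_word_row (t n : nat) (A B : 'M[R]_t) (W : n.-tuple word) (u : word) :
  \row_j ntrace (eval_word A B (u ++ tnth W j))
  = t%:R^-1 *: (mxvec (eval_word A B u)^T *m word_vectors A B W).
Proof.
apply/rowP=> j; rewrite !mxE /ntrace eval_word_cat mxtrace_mxvec mxE mulrC.
by congr (_ * _); apply: eq_bigr => k _; rewrite !mxE.
Qed.

(** For symmetric [A] and [B] the value of [rev u] is the transpose of that of [u], so each entry is
    a Frobenius inner product of word values. The Gram form yields both positivity and the rank
    bound t^2. *)
Lemma moment_mx_atom (t n : nat) (A B : 'M[R]_t) (W : n.-tuple word) :
  A^T = A -> B^T = B ->
  moment_mx W (fun w => ntrace (eval_word A B w))
  = t%:R^-1 *: ((word_vectors A B W)^T *m word_vectors A B W).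
Proof.
move=> hA hB; apply/row_matrixP=> i; rewrite linearZ /= row_mul.
have -> : row i (word_vectors A B W)^T
    = mxvec (eval_word A B (rev (tnth W i)))^T.
  by apply/rowP=> k; rewrite eval_word_rev// trmxK !mxE.
by rewrite -ntrace_word_row; apply/rowP=> j; rewrite !mxE.
Qed.

Lemma moment_mx_cons (n : nat) (W : n.-tuple word) (p : R * atom R) mu :
  moment_mx W (measure_moment (p :: mu))
  = p.1 *: moment_mx W (fun w => ntrace (eval_word (atX p.2) (atY p.2) w))
    + moment_mx W (measure_moment mu).
Proof. by apply/matrixP=> i j; rewrite !mxE measure_moment_cons. Qed.

Lemma sqnorm_ge0 (m : nat) (v : 'cV[R]_m) : 0 <= (v^T *m v) 0 0.
Proof. by rewrite mxE sumr_ge0// => i _; rewrite mxE -expr2 sqr_ge0. Qed.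

Lemma sqnorm_eq0 (m : nat) (v : 'cV[R]_m) : (v^T *m v) 0 0 = 0 -> v = 0.
Proof.
rewrite mxE => /eqP; rewrite psumr_eq0 => [/allP h|i _]; last first.
  by rewrite mxE -expr2 sqr_ge0.
apply/colP=> i; have := h i (mem_index_enum i).
by rewrite !mxE -expr2 sqrf_eq0 => /eqP.
Qed.

Lemma atom_form (t n : nat) (A B : 'M[R]_t) (W : n.-tuple word) (v : 'cV[R]_n) :
  A^T = A -> B^T = B ->
  (v^T *m moment_mx W (fun w => ntrace (eval_word A B w)) *m v) 0 0
  = t%:R^-1 * ((word_vectors A B W *m v)^T *m (word_vectors A B W *m v)) 0 0.
Proof.
move=> hA hB; rewrite moment_mx_atom// -scalemxAr -scalemxAl mxE trmx_mul.
by rewrite !mulmxA.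
Qed.

Lemma moment_mx_form_ge0 (n : nat) (W : n.-tuple word) mu (v : 'cV[R]_n) :
  all (fun p => (0 < p.1) && is_atom p.2) mu ->
  0 <= (v^T *m moment_mx W (measure_moment mu) *m v) 0 0.
Proof.
elim: mu => [_|p mu IH] /=.
  rewrite (_ : moment_mx _ _ = 0) ?mulmx0 ?mul0mx ?mxE//.
  by apply/matrixP=> i j; rewrite !mxE /measure_moment big_nil.
case/andP=> /andP[hp /and3P[ht /eqP hA /eqP hB]] /IH hmu.
rewrite moment_mx_cons mulmxDr mulmxDl mxE addr_ge0//.
rewrite -scalemxAr -scalemxAl mxE mulr_ge0 ?(ltW hp)// atom_form//.
by rewrite mulr_ge0 ?sqnorm_ge0// invr_ge0 ler0n.
Qed.

(** The form is a sum over the atoms of terms (lambda / t) |p(A,B)|^2, where p has coefficient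
    vector [v]. If it vanishes, then p(A,B) = 0 at every atom, and so tr(u p) = 0 for a word [u] of
    any length. *)
Lemma moment_mx_ker (n : nat) (W : n.-tuple word) mu (v : 'cV[R]_n) (u : word) :
  all (fun p => (0 < p.1) && is_atom p.2) mu ->
  (v^T *m moment_mx W (measure_moment mu) *m v) 0 0 = 0 ->
  (\row_j measure_moment mu (u ++ tnth W j)) *m v = 0.
Proof.
elim: mu => [_ _|p mu IH] /=.
  rewrite (_ : \row__ _ = 0) ?mul0mx//.
  by apply/rowP=> j; rewrite !mxE /measure_moment big_nil.
case/andP=> /andP[hp /and3P[ht /eqP hA /eqP hB]] hmu.
rewrite moment_mx_cons mulmxDr mulmxDl mxE => /eqP.
have hge := moment_mx_form_ge0 _ W _ v hmu.
rewrite -scalemxAr -scalemxAl [X in X + _]mxE atom_form// paddr_eq0//; last first.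
  by rewrite !mulr_ge0 ?sqnorm_ge0 ?(ltW hp)// invr_ge0 ler0n.
rewrite !mulf_eq0 invr_eq0 pnatr_eq0 (gt_eqF hp) (gtn_eqF ht) /=.
case/andP=> /eqP/sqnorm_eq0 h0 /eqP/(IH hmu) h1.
have -> : \row_j measure_moment (p :: mu) (u ++ tnth W j)
   = p.1 *: (\row_j ntrace (eval_word (atX p.2) (atY p.2) (u ++ tnth W j)))
     + \row_j measure_moment mu (u ++ tnth W j).
  by apply/rowP=> j; rewrite !mxE measure_moment_cons.
by rewrite mulmxDl h1 ntrace_word_row -!scalemxAl -mulmxA h0 mulmx0 !scaler0 addr0.
Qed.

Lemma measure_row_sub (n : nat) (W : n.-tuple word) mu (u : word) :
  all (fun p => (0 < p.1) && is_atom p.2) mu ->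
  (\row_j measure_moment mu (u ++ tnth W j)
     <= moment_mx W (measure_moment mu))%MS.
Proof.
move=> hmu; rewrite submxE; apply/eqP/row_matrixP=> i; apply/rowP=> j.
rewrite row0 mxE.
set M := moment_mx _ _; set r := \row__ _.
(* The columns of [cokermx M] are null vectors of [M], and a row that kills all of them lies in the
   row space of [M]. *)
have h : M *m col j (cokermx M) = 0.
  by rewrite colE mulmxA mulmx_coker mul0mx.
have := moment_mx_ker _ W mu (col j (cokermx M)) u hmu.
rewrite -/M -/r -mulmxA h mulmx0 mxE => /(_ erefl)/colP/(_ i).
by rewrite colE mulmxA -colE mxE => ->; rewrite !mxE.
Qed.

(** * Extensions of the moment sequence to degree 6 *)

Lemma size_words2 (i : 'I_7) : (size (tnth words2 i) <= 2)%N.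
Proof. by have /all_tnthP -> : all (fun w : word => size w <= 2)%N words2 by []. Qed.

Lemma M2_ext beta gamma :
  (forall w : word, (size w <= 4)%N -> gamma w = beta w) -> M2 gamma = M2 beta.
Proof.
move=> h; apply/matrixP=> i j; rewrite !mxE h// size_cat size_rev.
by rewrite (leq_add (size_words2 i) (size_words2 j)).
Qed.

Lemma words2_index (w : word) :
  (size w <= 2)%N -> exists i : 'I_7, tnth words2 i = w.
Proof.
case: w => [|[] [|[] [|//]]] _; [exists (inord 0)|exists (inord 1)|exists (inord 3)
  |exists (inord 4)|exists (inord 2)|exists (inord 5)|exists (inord 6)];
  by rewrite (tnth_nth [::]) inordK.
Qed.

Lemma tnth_words3_lshift (i : 'I_7) :
  tnth words3 (lshift 8 i) = tnth words2 i.
Proof. exact: tnth_lshift. Qed.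

Lemma words3_index (w : word) :
  (size w <= 3)%N -> exists i : 'I_(7 + 8), tnth words3 i = w.
Proof.
have [hw _|hw hw3] := leqP (size w) 2.
  have [i <-] := words2_index _ hw; exists (lshift 8 i).
  exact: tnth_words3_lshift.
have [i <-] : exists i : 'I_8, tnth words_deg3 i = w.
  case: w hw hw3 => [//|[] [//|[] [//|[] [|//]]]] _ _;
  [exists (inord 0)|exists (inord 1)|exists (inord 2)|exists (inord 3)
  |exists (inord 4)|exists (inord 5)|exists (inord 6)|exists (inord 7)];
  by rewrite (tnth_nth [::]) inordK.
exists (rshift 7 i); exact: tnth_rshift.
Qed.

(** The common ground of measures and flat extensions. The last clause carries each column relation
    r of M_2 over to L(u r) = 0 for words u of length 3. *)
Definition moment_extension beta gamma : Prop :=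
  [/\ tracial_seq 6 gamma,
      forall w : word, (size w <= 4)%N -> gamma w = beta w
    & forall u : word, (size u <= 3)%N ->
        (\row_j gamma (u ++ tnth words2 j) <= M2 beta)%MS].

Lemma moment_extension_rel beta gamma (w u : word) (a b c d : R) :
  moment_extension beta gamma -> (size w <= 2)%N -> (size u <= 3)%N ->
  mcol beta w = a *: mcol beta [::] + b *: mcol beta [:: LX]
     + c *: mcol beta [:: LY] + d *: mcol beta [:: LX; LY] ->
  gamma (u ++ w) = a * gamma u + b * gamma (u ++ [:: LX])
     + c * gamma (u ++ [:: LY]) + d * gamma (u ++ [:: LX; LY]).
Proof.
move=> [_ _ hext] hw /hext/submxP[C hC] hrel.
have E (v : word) : (size v <= 2)%N -> gamma (u ++ v) = (C *m mcol beta v) 0 0.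
  move=> /words2_index[i <-]; rewrite mcolE colE mulmxA -colE -hC.
  by rewrite !mxE.
have := E [::] isT; rewrite cats0 => ->; rewrite !E// hrel !mulmxDr -!scalemxAr.
by rewrite [LHS]mxE [X in X + _]mxE [X in X + _ + _]mxE; do !congr (_ + _);
  rewrite mxE.
Qed.

Lemma measure_extension beta mu :
  representing_measure beta mu -> moment_extension beta (measure_moment mu).
Proof.
case=> hmu _ hrep.
have hext w : (size w <= 4)%N -> measure_moment mu w = beta w by move/hrep.
split=> //; first exact: measure_moment_tracial.
move=> u _; rewrite -(M2_ext _ _ hext).
exact: measure_row_sub.
Qed.

Lemma measure_psd beta mu : representing_measure beta mu -> psd_mx (M2 beta).
Proof.
move=> hmu; have [hall _ hrep] := hmu; have [htr hb _] := measure_extension _ _ hmu.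
rewrite -(M2_ext _ _ hb).
split=> [|v]; last exact: moment_mx_form_ge0.
apply/matrixP=> i j; rewrite !mxE.
have [_ ->] := htr; first by rewrite rev_cat revK.
rewrite size_cat size_rev.
by rewrite (leq_trans (leq_add (size_words2 j) (size_words2 i))).
Qed.

Lemma M3_ulsubmx gamma : ulsubmx (M3 gamma) = M2 gamma.
Proof.
by apply/matrixP=> i j; rewrite !mxE !tnth_words3_lshift.
Qed.

Lemma mxrank_usub (m1 m2 n : nat) (N : 'M[R]_(m1 + m2, n)) :
  (\rank (usubmx N) <= \rank N)%N.
Proof. by apply: mxrankS; rewrite -[X in (_ <= X)%MS]vsubmxK -addsmxE addsmxSl. Qed.

Lemma mxrank_lsub (m n1 n2 : nat) (N : 'M[R]_(m, n1 + n2)) :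
  (\rank (lsubmx N) <= \rank N)%N.
Proof. by rewrite -mxrank_tr -[leqRHS]mxrank_tr trmx_lsub mxrank_usub. Qed.

(** The left block column of M_3 contains the rows of M_2, and its rank is at most that of M_3.
    Equal ranks therefore put all its rows, including those of words of length 3, into the row space
    of M_2. *)
Lemma flat_extension beta :
  has_flat_extension beta -> exists gamma, moment_extension beta gamma.
Proof.
case=> B [C [gamma [htr [hM hrk]]]]; exists gamma.
have hM2 : M2 gamma = M2 beta by rewrite -M3_ulsubmx hM block_mxKul.
split=> // [w hw|u hu].
  (* Cutting [w] after two letters writes it as U^* V with U and V of length at most 2, so its
     moment is an entry of M_2. *)
  have [i hi] : exists i, tnth words2 i = rev (take 2 w).
    by apply: words2_index; rewrite size_rev size_take_min geq_minl.
  have [j hj] : exists j, tnth words2 j = drop 2 w.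
    by apply: words2_index; rewrite size_drop leq_subLR.
  move/matrixP/(_ i j): hM2.
  by rewrite !mxE hi hj revK cat_take_drop.
have [k hk] : exists k, tnth words3 k = rev u.
  by apply: words3_index; rewrite size_rev.
have -> : \row_j gamma (u ++ tnth words2 j) = row k (lsubmx (M3 gamma)).
  by apply/rowP=> j; rewrite !mxE hk revK tnth_words3_lshift.
apply: submx_trans (row_sub _ _) _.
have hL : lsubmx (M3 gamma) = col_mx (M2 beta) B^T.
  by rewrite hM block_mxEh row_mxKl.
have hsub : (M2 beta <= lsubmx (M3 gamma))%MS by rewrite hL -addsmxE addsmxSl.
have hle : (\rank (lsubmx (M3 gamma)) <= \rank (M2 beta))%N.
  by rewrite -hrk mxrank_lsub.
by rewrite -(geq_leqif (mxrank_leqif_sup hsub)).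
Qed.

(** The matrix M_3 of one atom is a Gram matrix of vectors in dimension t^2, which bounds its rank
    by that of M_2; the reverse bound holds because M_2 is a corner of M_3. *)
Lemma atom_flat_extension beta (t : nat) (A B : 'M[R]_t) :
  A^T = A -> B^T = B -> (t * t <= \rank (M2 beta))%N ->
  (forall w : word, (size w <= 4)%N -> beta w = ntrace (eval_word A B w)) ->
  has_flat_extension beta.
Proof.
move=> hA hB hrk hbeta; pose gamma w := ntrace (eval_word A B w).
have hM2 : M2 gamma = M2 beta by apply: M2_ext => w /hbeta.
have hM3 : M3 gamma
    = t%:R^-1 *: ((word_vectors A B words3)^T *m word_vectors A B words3).
  exact: moment_mx_atom.
have hsym : (M3 gamma)^T = M3 gamma.
  by rewrite hM3 linearZ /= trmx_mul trmxK.
exists (ursubmx (M3 gamma)), (drsubmx (M3 gamma)), gamma; split.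
  exact: atom_tracial.
split; first by rewrite -hM2 -M3_ulsubmx trmx_ursub hsym submxK.
apply/eqP; rewrite eqn_leq; apply/andP; split.
  apply: leq_trans hrk; rewrite hM3.
  apply: leq_trans (mxrank_scale _ _) _.
  by apply: leq_trans (mxrankM_maxl _ _) _; apply: rank_leq_col.
rewrite -hM2 -M3_ulsubmx.
exact: leq_trans (mxrank_lsub _ _ _ _) (mxrank_usub _ _ _ _).
Qed.

(** * Consequences of the column relations *)

Lemma mcol_rel beta (w u : word) (a b c d : R) :
  (size u <= 2)%N ->
  mcol beta w = a *: mcol beta [::] + b *: mcol beta [:: LX]
     + c *: mcol beta [:: LY] + d *: mcol beta [:: LX; LY] ->
  beta (u ++ w) = a * beta u + b * beta (u ++ [:: LX])
     + c * beta (u ++ [:: LY]) + d * beta (u ++ [:: LX; LY]).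
Proof.
move=> hu; have [i hi] : exists i, tnth words2 i = rev u.
  by apply: words2_index; rewrite size_rev.
by move/colP/(_ i); rewrite !mxE hi revK cats0.
Qed.

(** Compare the two rows XY and YX of each relation: by cyclicity the columns 1, X, Y, X^2, Y^2
    agree there, while in the columns XY and YX the two entries differ by beta_XXYY - beta_XYXY up
    to sign. *)
Lemma rel_XY_coef beta (a1 b1 c1 d1 a2 b2 c2 d2 a3 b3 c3 d3 : R) :
  tracial_seq 4 beta -> nc_seq beta ->
  mcol beta [:: LX; LX] =
    a1 *: mcol beta [::] + b1 *: mcol beta [:: LX]
    + c1 *: mcol beta [:: LY] + d1 *: mcol beta [:: LX; LY] ->
  mcol beta [:: LY; LX] =
    a2 *: mcol beta [::] + b2 *: mcol beta [:: LX]
    + c2 *: mcol beta [:: LY] + d2 *: mcol beta [:: LX; LY] ->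
  mcol beta [:: LY; LY] =
    a3 *: mcol beta [::] + b3 *: mcol beta [:: LX]
    + c3 *: mcol beta [:: LY] + d3 *: mcol beta [:: LX; LY] ->
  d1 = 0 /\ d3 = 0 /\ d2 = -1.
Proof.
move=> hb /eqP; rewrite -subr_eq0 => hpq hXX hYX hYY.
have := mcol_rel _ _ [:: LX; LY] _ _ _ _ isT hXX.
have := mcol_rel _ _ [:: LY; LX] _ _ _ _ isT hXX.
have := mcol_rel _ _ [:: LX; LY] _ _ _ _ isT hYX.
have := mcol_rel _ _ [:: LY; LX] _ _ _ _ isT hYX.
have := mcol_rel _ _ [:: LX; LY] _ _ _ _ isT hYY.
have := mcol_rel _ _ [:: LY; LX] _ _ _ _ isT hYY => /=.
cyclic hb [:: LX; LY; LX; LX] [:: LY; LX; LX; LX].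
cyclic hb [:: LX; LY; LY; LY] [:: LY; LX; LY; LY].
cyclic hb [:: LY; LX; LX; LY] [:: LX; LX; LY; LY].
cyclic hb [:: LY; LX; LY; LX] [:: LX; LY; LX; LY].
cyclic hb [:: LX; LY; LY; LX] [:: LX; LX; LY; LY].
cyclic hb [:: LX; LY; LX] [:: LX; LX; LY].
cyclic hb [:: LY; LX; LX] [:: LX; LX; LY].
cyclic hb [:: LY; LX; LY] [:: LX; LY; LY].
cyclic hb [:: LY; LX] [:: LX; LY].
set p := beta [:: LX; LX; LY; LY] in hpq *.
set q := beta [:: LX; LY; LX; LY] in hpq *.
move=> h1 h2 h3 h4 h5 h6.
have can0 (x : R) : x * (p - q) = 0 -> x = 0.
  by move/eqP; rewrite mulf_eq0 (negPf hpq) orbF => /eqP.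
split; first by apply: can0; lra.
split; first by apply: can0; lra.
by apply/eqP; rewrite -subr_eq0 opprK; apply/eqP/can0; lra.
Qed.

(* With u = XY, the relations r give L(u(lr - rl)) = 0 for each letter l, and
   the quintic moments cancel in suitable combinations of these, leaving a
   multiple of beta_XXYY - beta_XYXY. *)
Lemma extension_conditions beta gamma (a1 b1 c1 a2 b2 c2 a3 b3 c3 : R) :
  nc_seq beta -> moment_extension beta gamma ->
  mcol beta [:: LX; LX] =
    a1 *: mcol beta [::] + b1 *: mcol beta [:: LX]
    + c1 *: mcol beta [:: LY] + 0 *: mcol beta [:: LX; LY] ->
  mcol beta [:: LY; LX] =
    a2 *: mcol beta [::] + b2 *: mcol beta [:: LX]
    + c2 *: mcol beta [:: LY] + (-1) *: mcol beta [:: LX; LY] ->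
  mcol beta [:: LY; LY] =
    a3 *: mcol beta [::] + b3 *: mcol beta [:: LX]
    + c3 *: mcol beta [:: LY] + 0 *: mcol beta [:: LX; LY] ->
  c1 = 0 /\ b3 = 0 /\ b2 = c3 /\ c2 = b1.
Proof.
move=> hpq hext hXX hYX hYY; have [hb hbeta _] := hext.
move/eqP: hpq; rewrite -!hbeta// -subr_eq0.
have relX u (hu : (size u <= 3)%N) :=
  moment_extension_rel beta gamma [:: LX; LX] u _ _ _ _ hext isT hu hXX.
have relY u (hu : (size u <= 3)%N) :=
  moment_extension_rel beta gamma [:: LY; LY] u _ _ _ _ hext isT hu hYY.
have relZ u (hu : (size u <= 3)%N) :=
  moment_extension_rel beta gamma [:: LY; LX] u _ _ _ _ hext isT hu hYX.
(* Since L(XY r l) = L(l XY r), the multipliers are XY l and l XY: for l = X they are XYX and XXY,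
   for l = Y they are XYY and YXY. *)
have := relX [:: LX; LY; LX] isT.
have := relX [:: LX; LX; LY] isT.
have := relX [:: LX; LY; LY] isT.
have := relX [:: LY; LX; LY] isT.
have := relY [:: LX; LY; LX] isT.
have := relY [:: LX; LX; LY] isT.
have := relY [:: LX; LY; LY] isT.
have := relY [:: LY; LX; LY] isT.
have := relZ [:: LX; LY; LX] isT.
have := relZ [:: LX; LX; LY] isT.
have := relZ [:: LX; LY; LY] isT.
have := relZ [:: LY; LX; LY] isT => /=.
cyclic hb [:: LX; LY; LX; LX; LX] [:: LX; LX; LY; LX; LX].
cyclic hb [:: LX; LY; LY; LX; LX] [:: LX; LX; LX; LY; LY].
cyclic hb [:: LX; LX; LY; LY; LX] [:: LX; LX; LX; LY; LY].
cyclic hb [:: LY; LX; LY; LX; LX] [:: LX; LX; LY; LX; LY].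
cyclic hb [:: LX; LY; LX; LY; LX] [:: LX; LX; LY; LX; LY].
cyclic hb [:: LX; LY; LX; LX; LY] [:: LX; LX; LY; LX; LY].
cyclic hb [:: LY; LX; LY; LY; LY] [:: LX; LY; LY; LY; LY].
cyclic hb [:: LX; LY; LY; LY; LX] [:: LX; LX; LY; LY; LY].
cyclic hb [:: LX; LY; LY; LX; LY] [:: LX; LY; LX; LY; LY].
cyclic hb [:: LY; LX; LY; LY; LX] [:: LX; LY; LX; LY; LY].
cyclic hb [:: LY; LX; LY; LX; LY] [:: LX; LY; LX; LY; LY].
cyclic hb [:: LX; LY; LX; LX] [:: LX; LX; LX; LY].
cyclic hb [:: LX; LX; LY; LX] [:: LX; LX; LX; LY].
cyclic hb [:: LY; LX; LY; LY] [:: LX; LY; LY; LY].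
cyclic hb [:: LX; LY; LY; LX] [:: LX; LX; LY; LY].
cyclic hb [:: LY; LX; LY; LX] [:: LX; LY; LX; LY].
cyclic hb [:: LX; LY; LX] [:: LX; LX; LY].
cyclic hb [:: LY; LX; LY] [:: LX; LY; LY].
set p := gamma [:: LX; LX; LY; LY].
set q := gamma [:: LX; LY; LX; LY].
move=> Z4 Z3 Z2 Z1 Y4 Y3 Y2 Y1 X4 X3 X2 X1 hpq.
have can0 (x : R) : x * (p - q) = 0 -> x = 0.
  by move/eqP; rewrite mulf_eq0 (negPf hpq) orbF => /eqP.
split; first by apply: can0; lra.
split; first by apply: can0; lra.
by split; apply/eqP; rewrite -subr_eq0; apply/eqP/can0; lra.
Qed.

(** * The 2 x 2 model *)

Definition necklaces4 : seq word :=
  [:: [::]; [:: LX]; [:: LY]; [:: LX; LX]; [:: LX; LY]; [:: LY; LY];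
      [:: LX; LX; LX]; [:: LX; LX; LY]; [:: LX; LY; LY]; [:: LY; LY; LY];
      [:: LX; LX; LX; LX]; [:: LX; LX; LX; LY]; [:: LX; LX; LY; LY];
      [:: LX; LY; LX; LY]; [:: LX; LY; LY; LY]; [:: LY; LY; LY; LY]].

Lemma necklaces4P (w : word) :
  (size w <= 4)%N -> exists k, cyclic_equiv w (nth [::] necklaces4 k).
Proof.
case: w => [|[] [|[] [|[] [|[] [|//]]]]] _;
  first [at_necklace 0%N | at_necklace 1%N | at_necklace 2%N | at_necklace 3%N
       | at_necklace 4%N | at_necklace 5%N | at_necklace 6%N | at_necklace 7%N
       | at_necklace 8%N | at_necklace 9%N | at_necklace 10%N
       | at_necklace 11%N | at_necklace 12%N | at_necklace 13%N
       | at_necklace 14%N | at_necklace 15%N].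
Qed.

Lemma tracial_seq4_ext beta gamma :
  tracial_seq 4 beta -> tracial_seq 4 gamma ->
  (forall k, beta (nth [::] necklaces4 k) = gamma (nth [::] necklaces4 k)) ->
  forall w : word, (size w <= 4)%N -> beta w = gamma w.
Proof.
move=> [hb _] [hg _] h w hw; have [k hk] := necklaces4P _ hw.
have hs : (size (nth [::] necklaces4 k) <= 4)%N.
  by case: hk hw => j ->; rewrite size_rot.
by rewrite (hb _ _ hs hk) (hg _ _ hs hk).
Qed.

Lemma mx2_eta (M : 'M[R]_2) : M = mx2 (M 0 0) (M 0 1) (M 1 0) (M 1 1).
Proof.
apply/matrixP=> i j; rewrite !mxE.
by case: i => [[|[|//]] hi]; case: j => [[|[|//]] hj] /=; congr (M _ _);
  apply: val_inj.
Qed.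

Lemma mulmx_mx2 (p q r s p' q' r' s' : R) :
  mx2 p q r s *m mx2 p' q' r' s'
  = mx2 (p * p' + q * r') (p * q' + q * s') (r * p' + s * r') (r * q' + s * s').
Proof.
apply/matrixP=> i j; rewrite !mxE !big_ord_recr big_ord0 /= add0r !mxE /=.
by case: (i == 0); case: (j == 0).
Qed.

Lemma addmx_mx2 (p q r s p' q' r' s' : R) :
  mx2 p q r s + mx2 p' q' r' s' = mx2 (p + p') (q + q') (r + r') (s + s').
Proof. by apply/matrixP=> i j; rewrite !mxE; case: (i == 0); case: (j == 0). Qed.

Lemma scalemx_mx2 (k p q r s : R) :
  k *: mx2 p q r s = mx2 (k * p) (k * q) (k * r) (k * s).
Proof. by apply/matrixP=> i j; rewrite !mxE; case: (i == 0); case: (j == 0). Qed.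

Lemma scalar_mx2 (k : R) : k%:M = mx2 k 0 0 k.
Proof. by rewrite [LHS]mx2_eta !mxE. Qed.

Lemma trmx_mx2 (p q r s : R) : (mx2 p q r s)^T = mx2 p r q s.
Proof. by apply/matrixP=> i j; rewrite !mxE; case: (i == 0); case: (j == 0). Qed.

Lemma mxtrace_mx2 (p q r s : R) : \tr (mx2 p q r s) = p + s.
Proof. by rewrite /mxtrace !big_ord_recr big_ord0 /= add0r !mxE. Qed.

(** The relations once the conditions hold: [b] is b_1 = c_2 and [c] is c_3 = b_2. *)
Definition quadratic_relations beta (a1 a2 a3 b c : R) : Prop :=
  [/\ mcol beta [:: LX; LX] =
        a1 *: mcol beta [::] + b *: mcol beta [:: LX]
        + 0 *: mcol beta [:: LY] + 0 *: mcol beta [:: LX; LY],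
      mcol beta [:: LY; LX] =
        a2 *: mcol beta [::] + c *: mcol beta [:: LX]
        + b *: mcol beta [:: LY] + (-1) *: mcol beta [:: LX; LY]
    & mcol beta [:: LY; LY] =
        a3 *: mcol beta [::] + 0 *: mcol beta [:: LX]
        + c *: mcol beta [:: LY] + 0 *: mcol beta [:: LX; LY]].

(** All moments are expressed recursively through those of X and Y. The second group consists of
    constraints: beta_XXY and beta_XYY can each be computed both from a square relation and from the
    relation for YX. *)
Lemma moment_equations beta (a1 a2 a3 b c : R) :
  tracial_seq 4 beta -> normalized beta ->
  quadratic_relations beta a1 a2 a3 b c ->
  (beta [:: LX; LX] = a1 + b * beta [:: LX]
   /\ beta [:: LX; LY] = (a2 + c * beta [:: LX] + b * beta [:: LY]) / 2%:R
   /\ beta [:: LY; LY] = a3 + c * beta [:: LY])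
  /\ (a1 * beta [:: LY] + b * beta [:: LX; LY]
      = (a2 * beta [:: LX] + c * beta [:: LX; LX] + b * beta [:: LX; LY]) / 2%:R
   /\ a3 * beta [:: LX] + c * beta [:: LX; LY]
      = (a2 * beta [:: LY] + c * beta [:: LX; LY] + b * beta [:: LY; LY]) / 2%:R)
  /\ (beta [:: LX; LX; LX] = a1 * beta [:: LX] + b * beta [:: LX; LX]
   /\ beta [:: LX; LX; LY] = a1 * beta [:: LY] + b * beta [:: LX; LY]
   /\ beta [:: LX; LY; LY] = a3 * beta [:: LX] + c * beta [:: LX; LY]
   /\ beta [:: LY; LY; LY] = a3 * beta [:: LY] + c * beta [:: LY; LY])
  /\ (beta [:: LX; LX; LX; LX] = a1 * beta [:: LX; LX] + b * beta [:: LX; LX; LX]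
   /\ beta [:: LX; LX; LX; LY] = a1 * beta [:: LX; LY] + b * beta [:: LX; LX; LY]
   /\ beta [:: LX; LX; LY; LY] = a1 * beta [:: LY; LY] + b * beta [:: LX; LY; LY]
   /\ beta [:: LX; LY; LX; LY] = a2 * beta [:: LX; LY] + c * beta [:: LX; LX; LY]
        + b * beta [:: LX; LY; LY] - beta [:: LX; LX; LY; LY]
   /\ beta [:: LX; LY; LY; LY] = a3 * beta [:: LX; LY] + c * beta [:: LX; LY; LY]
   /\ beta [:: LY; LY; LY; LY] = a3 * beta [:: LY; LY] + c * beta [:: LY; LY; LY]).
Proof.
move=> hb h1 [hXX hYX hYY].
have relX u hu := mcol_rel beta [:: LX; LX] u _ _ _ _ hu hXX.
have relZ u hu := mcol_rel beta [:: LY; LX] u _ _ _ _ hu hYX.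
have relY u hu := mcol_rel beta [:: LY; LY] u _ _ _ _ hu hYY.
have := relX [::] isT; have := relX [:: LX] isT; have := relX [:: LY] isT.
have := relX [:: LX; LX] isT; have := relX [:: LX; LY] isT.
have := relX [:: LY; LY] isT.
have := relZ [::] isT; have := relZ [:: LX] isT; have := relZ [:: LY] isT.
have := relZ [:: LY; LX] isT.
have := relY [::] isT; have := relY [:: LX] isT; have := relY [:: LY] isT.
have := relY [:: LX; LY] isT; have := relY [:: LY; LY] isT => /=.
rewrite h1 !mul0r !addr0 !mulr1.
cyclic hb [:: LX; LY; LX; LX] [:: LX; LX; LX; LY].
cyclic hb [:: LY; LY; LX; LX] [:: LX; LX; LY; LY].
cyclic hb [:: LY; LX; LX; LY] [:: LX; LX; LY; LY].
cyclic hb [:: LY; LX; LY; LX] [:: LX; LY; LX; LY].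
cyclic hb [:: LX; LY; LX] [:: LX; LX; LY].
cyclic hb [:: LY; LX; LX] [:: LX; LX; LY].
cyclic hb [:: LY; LX; LY] [:: LX; LY; LY].
cyclic hb [:: LY; LY; LX] [:: LX; LY; LY].
cyclic hb [:: LY; LX] [:: LX; LY].
by intros; do !split; lra.
Qed.

(** After centring, the two constraints form a homogeneous linear system for the first moments, with
    determinant al ga - de^2. Twice this determinant is beta_XXYY - beta_XYXY, which is nonzero. *)
Lemma first_moments beta (a1 a2 a3 b c : R) :
  tracial_seq 4 beta -> normalized beta -> nc_seq beta ->
  quadratic_relations beta a1 a2 a3 b c ->
  [/\ beta [:: LX] = b / 2%:R, beta [:: LY] = c / 2%:R
    & beta [:: LX; LX; LY; LY] - beta [:: LX; LY; LX; LY]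
      = 2%:R * ((a1 + b ^+ 2 / 4%:R) * (a3 + c ^+ 2 / 4%:R)
                - (a2 / 2%:R + b * c / 4%:R) ^+ 2)].
Proof.
move=> hb h1 /eqP; rewrite -subr_eq0 => hpq hrel.
have [[Exx [Exy Eyy]] [[K1 K2] [[_ [Exxy [Exyy _]]] [_ [_ [Ep [Eq _]]]]]]] :=
  moment_equations _ _ _ _ _ _ hb h1 hrel.
move: hpq; rewrite Eq Ep Exxy Exyy.
move: K1 K2; rewrite Exx Eyy Exy.
set x := beta [:: LX]; set y := beta [:: LY] => K1 K2 hpq.
pose al : R := a1 + b ^+ 2 / 4%:R; pose ga : R := a3 + c ^+ 2 / 4%:R.
pose de : R := a2 / 2%:R + b * c / 4%:R.
pose x' := x - b / 2%:R; pose y' := y - c / 2%:R.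
have L1 : al * y' - de * x' = 0 by rewrite /al /de /x' /y'; lra.
have L2 : ga * x' - de * y' = 0 by rewrite /ga /de /x' /y'; lra.
(* The expanded difference beta_XXYY - beta_XYXY equals twice the determinant only up to multiples
   of the left sides of [L1] and [L2]. *)
have D : forall t, t = 2%:R * (al * ga - de ^+ 2) + b * (ga * x' - de * y')
    + c * (al * y' - de * x') -> t = 2%:R * (al * ga - de ^+ 2).
  by move=> t ->; rewrite L1 L2 !mulr0 !addr0.
rewrite -/al -/ga -/de; move: hpq; set t := (X in X != 0) => hpq.
have tE : t = 2%:R * (al * ga - de ^+ 2).
  by apply: D; rewrite /t /al /ga /de /x' /y'; field.
have can0 (z : R) : t * z = 0 -> z = 0.
  by move/eqP; rewrite mulf_eq0 (negPf hpq) => /eqP.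
split=> //; apply/eqP; rewrite -subr_eq0; apply/eqP/can0; rewrite tE.
  (* Cramer's rule: the determinant times [x'] is a combination of [L1] and [L2]. *)
  rewrite -/x' (_ : _ * x' = 2%:R * (al * (ga * x' - de * y')
    + de * (al * y' - de * x'))); last by ring.
  by rewrite L1 L2 !mulr0 addr0 mulr0.
rewrite -/y' (_ : _ * y' = 2%:R * (ga * (al * y' - de * x')
    + de * (ga * x' - de * y'))); last by ring.
by rewrite L1 L2 !mulr0 addr0 mulr0.
Qed.

(** The centred atom is X' = diag(s,-s), Y' = ((e,f),(f,-e)), so X'^2 = s^2, Y'^2 = e^2 + f^2 and
    X'Y' + Y'X' = 2 s e. The three equations for a_1, a_2, a_3 match these with al, ga, de, and one
    word per cyclic class remains to be checked. *)
Lemma model_moments beta (a1 a2 a3 b c s e f : R) :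
  tracial_seq 4 beta -> normalized beta -> nc_seq beta ->
  quadratic_relations beta a1 a2 a3 b c ->
  a1 = s ^+ 2 - b ^+ 2 / 4%:R -> a2 = 2%:R * s * e - b * c / 2%:R ->
  a3 = e ^+ 2 + f ^+ 2 - c ^+ 2 / 4%:R ->
  forall w : word, (size w <= 4)%N ->
    beta w = ntrace (eval_word (mx2 (s + b / 2%:R) 0 0 (- s + b / 2%:R))
                        (mx2 (e + c / 2%:R) f f (- e + c / 2%:R)) w).
Proof.
move=> hb h1 hnc hrel ha1 ha2 ha3; apply: tracial_seq4_ext => //.
  by apply: atom_tracial; rewrite trmx_mx2.
have [Ex Ey _] := first_moments _ _ _ _ _ _ hb h1 hnc hrel.
have [[Exx [Exy Eyy]] [_ [[Exxx [Exxy [Exyy Eyyy]]]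
  [Exxxx [Exxxy [Ep [Eq [Exyyy Eyyyy]]]]]]]] :=
  moment_equations _ _ _ _ _ _ hb h1 hrel.
have E := (Exxxx, Exxxy, Eq, Ep, Exyyy, Eyyyy, Exxx, Exxy, Exyy, Eyyy, Exx, Exy,
  Eyy, Ex, Ey, ha1, ha2, ha3).
have calc (w : word) p q r s' :
    eval_word (mx2 (s + b / 2%:R) 0 0 (- s + b / 2%:R))
      (mx2 (e + c / 2%:R) f f (- e + c / 2%:R)) w = mx2 p q r s' ->
    beta w = (p + s') / 2%:R ->
    beta w = ntrace (eval_word (mx2 (s + b / 2%:R) 0 0 (- s + b / 2%:R))
                        (mx2 (e + c / 2%:R) f f (- e + c / 2%:R)) w).
  by move=> -> ->; rewrite /ntrace mxtrace_mx2.
do 16! [case; first by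
  (apply: calc; [rewrite /= /eval_word ?big_cons big_nil ?mulmx1 ?mulmx_mx2
                   ?scalar_mx2; reflexivity
                |rewrite /= ?h1 ?E; field])].
(* Past the 16 representatives [nth] returns its default, the empty word. *)
move=> k; apply: calc; first by rewrite /= nth_nil /eval_word big_nil scalar_mx2.
by rewrite /= nth_nil h1; field.
Qed.

(** * Types of measures *)

Definition max_size mu : nat := \max_(p <- mu) asize p.2.

Lemma size_mtype mu : size (mtype mu) = max_size mu.
Proof. by rewrite size_map size_iota. Qed.

Lemma nth_mtype mu (i : nat) :
  (i < max_size mu)%N ->
  nth 0%N (mtype mu) i = count (fun p => asize p.2 == i.+1) mu.
Proof. by move=> hi; rewrite (nth_map 0%N) ?size_iota// nth_iota. Qed.

Lemma asize_le_max mu : all (fun p => asize p.2 <= max_size mu)%N mu.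
Proof.
rewrite /max_size; elim: mu => [//|p mu IH] /=.
rewrite big_cons leq_maxl; apply: sub_all IH => q /leq_trans; apply.
exact: leq_maxr.
Qed.

Lemma max_size_attained mu :
  (0 < max_size mu)%N -> has (fun p => asize p.2 == max_size mu) mu.
Proof.
rewrite /max_size; elim: mu => [|p mu IH] /=; first by rewrite big_nil.
rewrite big_cons.
case: (leqP (asize p.2) (\max_(q <- mu) asize q.2)) => [h hp|h _];
  last by rewrite eqxx.
by rewrite IH ?orbT.
Qed.

(** Matrices of size at most 1 commute. *)
Lemma size1_moment_XXYY mu :
  all (fun p => asize p.2 <= 1)%N mu ->
  measure_moment mu [:: LX; LX; LY; LY] = measure_moment mu [:: LX; LY; LX; LY].
Proof.
elim: mu => [_|[l [t A B]] mu IH] /=; first by rewrite /measure_moment !big_nil.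
case/andP=> ht /IH; rewrite !measure_moment_cons => -> /=; congr (_ * ntrace _ + _).
rewrite /eval_word !big_cons !big_nil.
suff hAB : A *m B = B *m A by rewrite [X in A *m X]mulmxA hAB -mulmxA.
case: t ht A B => [|[|//]] _ A B; first by rewrite [LHS]flatmx0 [RHS]flatmx0.
by rewrite [A]mx11_scalar scalar_mxC.
Qed.

Lemma nc_measure_size beta mu :
  nc_seq beta -> representing_measure beta mu -> (1 < size (mtype mu))%N.
Proof.
move=> hnc [_ _ hrep]; rewrite size_mtype ltnNge; apply/negP=> hmax.
apply: hnc; rewrite !hrep// -!/(measure_moment _ _).
apply: size1_moment_XXYY; apply: sub_all (asize_le_max mu) => p.
by move/leq_trans; apply.
Qed.

(** Every representing measure has r >= 2, and if r = 2 then some atom attains this size, so m_2 >=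
    1; nothing lies below (0,1). *)
Lemma type01_minimal beta mu :
  nc_seq beta -> representing_measure beta mu -> mtype mu = [:: 0%N; 1%N] ->
  minimal_measure beta mu.
Proof.
move=> hnc hmu ht; split=> // nu hnu.
have hs := nc_measure_size _ _ hnc hnu.
rewrite ht; case=> [|[hs2 [i [hi _]]]]; first by rewrite ltnNge hs.
case: i hi => [|[|i]] /=; rewrite ?ltn0 ?nth_nil// ltnS leqn0.
move: hs2; rewrite size_mtype /= => hs2.
rewrite nth_mtype ?hs2// eqn0Ngt -has_count.
by have := max_size_attained nu; rewrite hs2 => ->.
Qed.

(** Each of r > 2, m_2 > 1 and m_1 > 0 would make [nu] smaller than [mu]. *)
Lemma minimal_type01 beta mu nu :
  nc_seq beta -> representing_measure beta nu -> mtype nu = [:: 0%N; 1%N] ->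
  minimal_measure beta mu -> mtype mu = [:: 0%N; 1%N].
Proof.
move=> hnc hnu ht [hmu /(_ _ hnu)]; rewrite ht => hlt.
have hs := nc_measure_size _ _ hnc hmu.
have hs2 : size (mtype mu) = 2%N.
  apply/eqP; rewrite eqn_leq hs andbT leqNgt; apply/negP=> h.
  by apply: hlt; left.
case E : (mtype mu) hs2 hlt => [|m1 [|m2 [|//]]] // _ hlt.
have := size_mtype mu; rewrite E /= => hmax.
have hm2 : (0 < m2)%N.
  have -> : m2 = count (fun p => asize p.2 == 2)%N mu.
    by rewrite -nth_mtype -?hmax// E.
  by rewrite -has_count hmax max_size_attained// -hmax.
have e2 : m2 = 1%N.
  apply/eqP; rewrite eqn_leq hm2 andbT leqNgt; apply/negP=> h.
  by apply: hlt; right; split=> //; exists 1%N; split=> // -[|[|j]].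
move: hlt; rewrite e2 => hlt; congr [:: _; _]; apply/eqP; rewrite -leqn0 leqNgt.
apply/negP=> h; apply: hlt; right; split=> //; exists 0%N; split=> //.
by move=> [|[|j]].
Qed.

Lemma type01_single beta mu :
  representing_measure beta mu -> mtype mu = [:: 0%N; 1%N] ->
  exists A B : 'M[R]_2, [/\ mu = [:: (1, Atom A B)], A^T = A & B^T = B].
Proof.
move=> [hmu h1 _] ht; have := size_mtype mu; rewrite ht /= => hmax.
have c1 := nth_mtype mu 0; have c2 := nth_mtype mu 1.
rewrite -hmax ht /= in c1 c2; move: (c1 isT) (c2 isT) => {}c1 {}c2.
(* All atoms have size 1 or 2, so their number is m_1 + m_2 = 0 + 1. *)
have hsz : size mu = 1%N.
  rewrite -[RHS]add0n [X in (X + _)%N]c1 [X in (_ + X)%N]c2.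
  have := asize_le_max mu; rewrite -hmax.
  elim: mu hmu {h1 ht hmax c1 c2} => [//|p mu IH] /=.
  case/andP=> /andP[_ /and3P[hp _ _]] /IH{}IH /andP[hp2 /IH ->].
  by case: (asize p.2) hp hp2 => [|[|[|]]] //= _ _; rewrite ?addnS ?addSn.
case: mu hsz hmu h1 {ht hmax c1} c2 => [//|[l [t A B]] [|//]] _ /=.
rewrite big_seq1 /= andbT addn0 => /andP[_ /and3P[_ /eqP hA /eqP hB]] ->.
by case: eqP => [ht _|//]; move: A B hA hB; rewrite ht => A B hA hB; exists A, B.
Qed.

(** * The atom and its uniqueness *)

(** For P = cos(theta), Q = sin(theta) the half-angle formulas give k and l up to sign; the sign of
    l is chosen to be that of Q. *)
Lemma half_angle (P Q : R) :
  P ^+ 2 + Q ^+ 2 = 1 ->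
  exists k l : R, [/\ k ^+ 2 + l ^+ 2 = 1, k ^+ 2 - l ^+ 2 = P
    & 2%:R * k * l = Q].
Proof.
move=> h; have P1 : 0 <= (1 + P) / 2%:R by nra.
have P2 : 0 <= (1 - P) / 2%:R by nra.
pose k := Num.sqrt ((1 + P) / 2%:R); pose l := Num.sqrt ((1 - P) / 2%:R).
have hk : k ^+ 2 = (1 + P) / 2%:R by rewrite sqr_sqrtr.
have hl : l ^+ 2 = (1 - P) / 2%:R by rewrite sqr_sqrtr.
have hkl : k * l = `|Q / 2%:R|.
  rewrite -sqrtrM// -sqrtr_sqr; congr Num.sqrt.
  by rewrite expr_div_n -[Q ^+ 2](addKr (P ^+ 2)) h; field.
case: (lerP 0 Q) => hQ.
  exists k, l; split; rewrite ?hk ?hl; [by field|by field|].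
  by rewrite -mulrA hkl ger0_norm; [field|rewrite divr_ge0].
exists k, (- l); split; rewrite ?sqrrN ?hk ?hl; [by field|by field|].
rewrite mulrN -mulrA hkl ltr0_norm; first by field.
by rewrite ltr_pdivrMr// mul0r.
Qed.

(* The first column of U is the unit vector at half the angle of (p, q); the
   sign ep of its second column is forced by the sign of f. *)
Lemma orth_conj_model (s e f p q r g b c : R) :
  0 < s -> p ^+ 2 + q ^+ 2 = s ^+ 2 -> r ^+ 2 + g ^+ 2 = e ^+ 2 + f ^+ 2 ->
  p * r + q * g = s * e ->
  exists U : 'M[R]_2, [/\ U *m U^T = 1%:M,
    mx2 (p + b) q q (- p + b) = U *m mx2 (s + b) 0 0 (- s + b) *m U^T
  & mx2 (r + c) g g (- r + c) = U *m mx2 (e + c) f f (- e + c) *m U^T].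
Proof.
move=> hs hpq hrg hprg; have s0 : s != 0 by rewrite gt_eqF.
pose P := p / s; pose Q := q / s.
have hPQ : P ^+ 2 + Q ^+ 2 = 1.
  by rewrite /P /Q !expr_div_n -mulrDl hpq divff// expf_neq0.
have he : e = P * r + Q * g.
  by apply: (mulfI s0); rewrite -hprg /P /Q; field.
(* In the orthonormal basis (P,Q), (-Q,P) the vector (r,g) has coordinates (e,h); comparing norms
   gives h^2 = f^2. *)
pose h := P * g - Q * r.
have hr : r = P * e - Q * h.
  by rewrite -[LHS]mul1r -hPQ he /h; ring.
have hg : g = Q * e + P * h.
  by rewrite -[LHS]mul1r -hPQ he /h; ring.
have hp : p = s * P by rewrite /P; field.
have hq : q = s * Q by rewrite /Q; field.
have [ep ep1 hep] : exists2 ep : R, ep = 1 \/ ep = -1 & h = ep * f.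
  have : h ^+ 2 = f ^+ 2.
    apply: (addrI (e ^+ 2)); rewrite -hrg -[RHS]mul1r -hPQ he /h; ring.
  move/eqP; rewrite eqf_sqr => /orP[]/eqP ->.
    by exists 1; rewrite ?mul1r //; left.
  by exists (-1); rewrite ?mulN1r //; right.
have [k [l [hkl hP hQ]]] := half_angle _ _ hPQ.
rewrite hp hq hr hg hep -hP -hQ; move: hkl ep1; clear => hkl hep.
(* Multiplying the shifts [b] and [c] by k^2 + l^2 = 1 turns the entries into polynomial
   identities. *)
have kl (x : R) : x * (k ^+ 2 + l ^+ 2) = x by rewrite hkl mulr1.
exists (mx2 k (- (ep * l)) l (ep * k)).
rewrite !trmx_mx2 !mulmx_mx2 scalar_mx2 -[X in mx2 X 0 0 X]hkl.
case: hep => ->; split; congr mx2; try ring.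
- by rewrite -[X in _ + X = _](kl b); ring.
- by rewrite -[X in _ + X = _](kl b); ring.
- by rewrite -[X in _ + X = _](kl c); ring.
- by rewrite -[X in _ + X = _](kl c); ring.
- by rewrite -[X in _ + X = _](kl b); ring.
- by rewrite -[X in _ + X = _](kl b); ring.
- by rewrite -[X in _ + X = _](kl c); ring.
- by rewrite -[X in _ + X = _](kl c); ring.
Qed.

Lemma psd_form2 (n : nat) (M : 'M[R]_n) (i j : 'I_n) (x y : R) :
  psd_mx M -> 0 <= x ^+ 2 * M i i + x * y * (M i j + M j i) + y ^+ 2 * M j j.
Proof.
move=> [_]; pose D k : 'cV[R]_n := delta_mx k 0.
have E k l : ((D k)^T *m M *m D l) 0 0 = M k l.
  by rewrite /D trmx_delta -rowE -colE !mxE.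
have trE : (x *: D i + y *: D j)^T = x *: (D i)^T + y *: (D j)^T.
  by rewrite linearD !linearZ.
move/(_ (x *: D i + y *: D j)); rewrite trE !mulmxDl !mulmxDr.
rewrite -!scalemxAl -!scalemxAr.
have mxD (u v : 'M[R]_1) : (u + v) 0 0 = u 0 0 + v 0 0 by rewrite mxE.
have mxZ k (u : 'M[R]_1) : (k *: u) 0 0 = k * u 0 0 by rewrite mxE.
rewrite !mxD !mxZ !E => h; apply: le_trans h _.
by rewrite le_eqVlt; apply/orP; left; apply/eqP; ring.
Qed.

(** Testing M_2 on X - b/2, Y - c/2 and XY - YX gives al >= 0, ga >= 0 and beta_XXYY >= beta_XYXY.
    The last is strict for a nc sequence, so al ga > de^2 >= 0, and neither factor vanishes. *)
Lemma psd_parameters beta (a1 a2 a3 b c : R) :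
  tracial_seq 4 beta -> normalized beta -> nc_seq beta ->
  quadratic_relations beta a1 a2 a3 b c -> psd_mx (M2 beta) ->
  [/\ 0 < a1 + b ^+ 2 / 4%:R, 0 < a3 + c ^+ 2 / 4%:R
    & (a2 / 2%:R + b * c / 4%:R) ^+ 2
      < (a1 + b ^+ 2 / 4%:R) * (a3 + c ^+ 2 / 4%:R)].
Proof.
move=> hb h1 hnc hrel hpsd.
have [Ex Ey Epq] := first_moments _ _ _ _ _ _ hb h1 hnc hrel.
have [[Exx [_ Eyy]] _] := moment_equations _ _ _ _ _ _ hb h1 hrel.
have E (i j : nat) (x y : R) (hi : (i < 7)%N) (hj : (j < 7)%N) :
    0 <= x ^+ 2 * beta (rev (nth [::] words2 i) ++ nth [::] words2 i)
     + x * y * (beta (rev (nth [::] words2 i) ++ nth [::] words2 j)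
       + beta (rev (nth [::] words2 j) ++ nth [::] words2 i))
     + y ^+ 2 * beta (rev (nth [::] words2 j) ++ nth [::] words2 j).
  have := psd_form2 _ _ (Ordinal hi) (Ordinal hj) x y hpsd.
  by rewrite !mxE !(tnth_nth [::]).
have al0 : 0 <= a1 + b ^+ 2 / 4%:R.
  have := E 0%N 1%N (- b / 2%:R) 1 isT isT.
  by rewrite /= h1 Exx Ex; lra.
have ga0 : 0 <= a3 + c ^+ 2 / 4%:R.
  have := E 0%N 2%N (- c / 2%:R) 1 isT isT.
  by rewrite /= h1 Eyy Ey; lra.
have hpq : beta [:: LX; LX; LY; LY] != beta [:: LX; LY; LX; LY] by apply/eqP.
have D0 : beta [:: LX; LY; LX; LY] <= beta [:: LX; LX; LY; LY].
  have := E 4%N 5%N 1 (-1) isT isT => /=.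
  cyclic hb [:: LY; LX; LX; LY] [:: LX; LX; LY; LY].
  cyclic hb [:: LY; LX; LY; LX] [:: LX; LY; LX; LY].
  cyclic hb [:: LX; LY; LY; LX] [:: LX; LX; LY; LY].
  by lra.
have D : (a2 / 2%:R + b * c / 4%:R) ^+ 2
      < (a1 + b ^+ 2 / 4%:R) * (a3 + c ^+ 2 / 4%:R).
  have : beta [:: LX; LY; LX; LY] < beta [:: LX; LX; LY; LY].
    by rewrite lt_neqAle eq_sym hpq.
  by rewrite -subr_gt0 Epq pmulr_rgt0// subr_gt0.
have := le_lt_trans (sqr_ge0 _) D.
split=> //; rewrite lt_neqAle ?al0 ?ga0 andbT eq_sym; apply/eqP=> h0.
  by move: H; rewrite h0 mul0r ltxx.
by move: H; rewrite h0 mulr0 ltxx.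
Qed.

(** Here al = s^2 and ga = t^2, and a = 2 de / (s t) is twice the cosine of the angle between X' and
    Y'; thus s e = de and e^2 + f^2 = ga. *)
Lemma model_parameters (a1 a2 a3 b c : R) :
  0 < a1 + b ^+ 2 / 4%:R -> 0 < a3 + c ^+ 2 / 4%:R ->
  (a2 / 2%:R + b * c / 4%:R) ^+ 2
    < (a1 + b ^+ 2 / 4%:R) * (a3 + c ^+ 2 / 4%:R) ->
  let a := (4%:R * a2 + 2%:R * b * c)
           / Num.sqrt ((4%:R * a1 + b ^+ 2) * (4%:R * a3 + c ^+ 2)) in
  let s := Num.sqrt (a1 + b ^+ 2 / 4%:R) in
  let t := Num.sqrt (a3 + c ^+ 2 / 4%:R) in
  let e := t * (a / 2%:R) in
  let f := t * (Num.sqrt (4%:R - a ^+ 2) / 2%:R) in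
  [/\ 0 < s, a1 = s ^+ 2 - b ^+ 2 / 4%:R, a2 = 2%:R * s * e - b * c / 2%:R
    & a3 = e ^+ 2 + f ^+ 2 - c ^+ 2 / 4%:R].
Proof.
move=> hal hga hD a s t e f.
have s0 : 0 < s by rewrite sqrtr_gt0.
have t0 : 0 < t by rewrite sqrtr_gt0.
have s2 : s ^+ 2 = a1 + b ^+ 2 / 4%:R by rewrite sqr_sqrtr// ltW.
have t2 : t ^+ 2 = a3 + c ^+ 2 / 4%:R by rewrite sqr_sqrtr// ltW.
have sN0 : s != 0 by rewrite gt_eqF.
have tN0 : t != 0 by rewrite gt_eqF.
have ha : a = 2%:R * (a2 / 2%:R + b * c / 4%:R) / (s * t).
  rewrite /a (_ : _ * (_ + _) = (4%:R * (s * t)) ^+ 2); last first.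
    by rewrite !exprMn s2 t2; field.
  rewrite sqrtr_sqr ger0_norm ?mulr_ge0 ?ltW//.
  by field; rewrite ?sN0 ?tN0.
(* [Num.sqrt] is 0 at negative arguments, so squaring [f] requires 4 - a^2 >= 0; this follows from
   de^2 < al ga. *)
have a4 : a ^+ 2 <= 4%:R.
  rewrite ha expr_div_n ler_pdivrMr ?exprn_gt0 ?mulr_gt0// !exprMn s2 t2.
  by rewrite -natrX ler_pM2l// ltW.
split=> //.
- by rewrite s2 addrK.
- by rewrite /e ha; field; rewrite ?sN0 ?tN0.
have hf : f ^+ 2 = t ^+ 2 * (4%:R - a ^+ 2) / 4%:R.
  by rewrite /f exprMn expr_div_n [_ (4%:R - _) ^+ 2]sqr_sqrtr ?subr_ge0//; field.
have -> : e ^+ 2 + f ^+ 2 = t ^+ 2 by rewrite hf /e; field.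
by rewrite t2 addrK.
Qed.

(** First moments fix the traces, and second moments fix the inner products of the traceless parts.
    These symmetric traceless parts form a plane, where equal inner products mean orthogonal
    conjugacy. *)
Lemma orth_equiv_model (s b c e f : R) (A B : 'M[R]_2) :
  0 < s -> A^T = A -> B^T = B ->
  let X := mx2 (s + b) 0 0 (- s + b) in
  let Y := mx2 (e + c) f f (- e + c) in
  (forall w : word, (size w <= 2)%N ->
     ntrace (eval_word A B w) = ntrace (eval_word X Y w)) ->
  orth_equiv (Atom X Y) (Atom A B).
Proof.
move=> hs; rewrite [A]mx2_eta [B]mx2_eta !trmx_mx2.
move: (A 0 0) (A 0 1) (A 1 0) (A 1 1) (B 0 0) (B 0 1) (B 1 0) (B 1 1) => {A B}.
move=> p q q' p' r g g' r' hA hB X Y hw.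
have qE : q' = q by move/matrixP/(_ 0 1): hA; rewrite !mxE.
have gE : g' = g by move/matrixP/(_ 0 1): hB; rewrite !mxE.
move: hw; rewrite {}/X {}/Y qE gE => hw.
have trX := hw [:: LX] isT; have trY := hw [:: LY] isT.
have trXX := hw [:: LX; LX] isT; have trXY := hw [:: LX; LY] isT.
have trYY := hw [:: LY; LY] isT.
move: trX trY trXX trXY trYY.
rewrite /eval_word !big_cons !big_nil !mulmx1 !mulmx_mx2 /ntrace.
rewrite !mxtrace_mx2 => trX trY trXX trXY trYY {hw}.
(* Splits off half the trace, leaving the traceless parts with diagonal (P,-P) and (Q,-Q). *)
have hp' : p' = - ((p - p') / 2%:R) + b by lra.
have hp : p = (p - p') / 2%:R + b by lra.
have hr' : r' = - ((r - r') / 2%:R) + c by lra.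
have hr : r = (r - r') / 2%:R + c by lra.
move: hp hp' hr hr' trXX trXY trYY.
move: ((p - p') / 2%:R) ((r - r') / 2%:R) => P Q -> -> -> -> trXX trXY trYY.
have h1 : P ^+ 2 + q ^+ 2 = s ^+ 2 by lra.
have h2 : Q ^+ 2 + g ^+ 2 = e ^+ 2 + f ^+ 2 by lra.
have h3 : P * Q + q * g = s * e by lra.
have [U [hU hUX hUY]] := orth_conj_model s e f P q Q g b c hs h1 h2 h3.
by exists U; split=> //; rewrite hUX hUY.
Qed.

End Rank4.

(** * Existence of a nc measure in rank 4 and uniqueness of its atom *)

Theorem theorem3p1 (R : realType) (beta : word -> R)
    (a1 b1 c1 d1 a2 b2 c2 d2 a3 b3 c3 d3 : R)
    (hbeta : tracial_seq 4 beta)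
    (hnorm : normalized beta)
    (hnc : nc_seq beta)
    (hrank : \rank (M2 beta) = 4%N)
    (hbasis : basis_of (colspace (M2 beta))
       [:: mcol beta [::]; mcol beta [:: LX]; mcol beta [:: LY];
           mcol beta [:: LX; LY]])
    (hXX : mcol beta [:: LX; LX] =
       a1 *: mcol beta [::] + b1 *: mcol beta [:: LX]
       + c1 *: mcol beta [:: LY] + d1 *: mcol beta [:: LX; LY])
    (hYX : mcol beta [:: LY; LX] =
       a2 *: mcol beta [::] + b2 *: mcol beta [:: LX]
       + c2 *: mcol beta [:: LY] + d2 *: mcol beta [:: LX; LY])
    (hYY : mcol beta [:: LY; LY] =
       a3 *: mcol beta [::] + b3 *: mcol beta [:: LX]
       + c3 *: mcol beta [:: LY] + d3 *: mcol beta [:: LX; LY]) :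
  (d1 = 0 /\ d3 = 0 /\ d2 = -1)
  /\ (has_nc_measure beta <-> psd_mx (M2 beta) /\ has_flat_extension beta)
  /\ (has_nc_measure beta <->
      psd_mx (M2 beta) /\ c1 = 0 /\ b3 = 0 /\ b2 = c3 /\ c2 = b1)
  /\ (has_nc_measure beta ->
      let a := (4%:R * a2 + 2%:R * b1 * c3)
               / Num.sqrt ((4%:R * a1 + b1 ^+ 2) * (4%:R * a3 + c3 ^+ 2)) in
      let sX := Num.sqrt (a1 + b1 ^+ 2 / 4%:R) in
      let X := mx2 sX 0 0 (- sX) + (b1 / 2%:R) *: 1%:M in
      let Y := Num.sqrt (a3 + c3 ^+ 2 / 4%:R)
                 *: mx2 (a / 2%:R) (Num.sqrt (4%:R - a ^+ 2) / 2%:R)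
                        (Num.sqrt (4%:R - a ^+ 2) / 2%:R) (- (a / 2%:R))
               + (c3 / 2%:R) *: 1%:M in
      minimal_measure beta [:: (1, Atom X Y)]
      /\ forall mu : measure R, minimal_measure beta mu ->
           mtype mu = [:: 0%N; 1%N]
           /\ exists x : atom R, mu = [:: (1, x)] /\ orth_equiv (Atom X Y) x).
Proof.
have hd := rel_XY_coef _ _ _ _ _ _ _ _ _ _ _ _ _ hbeta hnc hXX hYX hYY.
have [hd1 [hd3 hd2]] := hd; split=> // {hd}.
rewrite hd1 in hXX; rewrite hd2 in hYX; rewrite hd3 in hYY.
pose cond := c1 = 0 /\ b3 = 0 /\ b2 = c3 /\ c2 = b1.
(* Serves both a representing measure and a flat extension. *)
have ext_cond gamma : moment_extension beta gamma -> cond.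
  by move=> hext; apply: extension_conditions hnc hext hXX hYX hYY.
have nc_psd : has_nc_measure beta -> psd_mx (M2 beta) /\ cond.
  case=> mu [[hmu _] _]; have hext := measure_extension _ _ hmu.
  split; last exact: ext_cond hext.
  exact: measure_psd hmu.
pose a := (4%:R * a2 + 2%:R * b1 * c3)
            / Num.sqrt ((4%:R * a1 + b1 ^+ 2) * (4%:R * a3 + c3 ^+ 2)).
pose s := Num.sqrt (a1 + b1 ^+ 2 / 4%:R).
pose t := Num.sqrt (a3 + c3 ^+ 2 / 4%:R).
pose e := t * (a / 2%:R).
pose f := t * (Num.sqrt (4%:R - a ^+ 2) / 2%:R).
pose X := mx2 (s + b1 / 2%:R) 0 0 (- s + b1 / 2%:R).
pose Y := mx2 (e + c3 / 2%:R) f f (- e + c3 / 2%:R).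
have model : psd_mx (M2 beta) /\ cond -> 0 < s /\
    forall w : word, (size w <= 4)%N -> beta w = ntrace (eval_word X Y w).
  case=> hpsd [hc1 [hb3 [hb2 hc2]]].
  have hrel : quadratic_relations beta a1 a2 a3 b1 c3.
    by split; rewrite ?hXX ?hYX ?hYY ?hc1 ?hb3 ?hb2 ?hc2.
  have [hal hga hD] := psd_parameters _ _ _ _ _ _ hbeta hnorm hnc hrel hpsd.
  have [hs ha1 ha2 ha3] := model_parameters _ _ _ _ _ hal hga hD.
  by split=> //; apply: model_moments hbeta hnorm hnc hrel ha1 ha2 ha3.
have XT : X^T = X by rewrite trmx_mx2.
have YT : Y^T = Y by rewrite trmx_mx2.
pose mu0 : measure R := [:: (1, Atom X Y)].
have mu0_type : mtype mu0 = [:: 0%N; 1%N].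
  by rewrite /mtype big_seq1.
have mu0_rep : psd_mx (M2 beta) /\ cond -> representing_measure beta mu0.
  move=> /model[_ hw]; split; first by rewrite /= ltr01 /is_atom /= XT YT !eqxx.
    by rewrite big_seq1.
  by move=> w /hw ->; rewrite big_seq1 mul1r.
have mu0_min h := type01_minimal _ _ hnc (mu0_rep h) mu0_type.
have psd_nc : psd_mx (M2 beta) /\ cond -> has_nc_measure beta.
  by move=> /mu0_min h; exists mu0; split=> //; rewrite mu0_type.
split.
  split=> [/nc_psd h|[hpsd /flat_extension[gamma /ext_cond hcond]]].
    split; first by case: h.
    (* For the 2 x 2 atom t^2 = 4, exactly the rank of M_2, so its moments up to degree 6 are a flat
       extension. *)
    have [_ hw] := model h.
    by apply: atom_flat_extension XT YT _ hw; rewrite hrank.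
  exact: psd_nc.
split; first by split=> [/nc_psd|/psd_nc].
move=> /nc_psd h /=; rewrite -/a -/s -/t.
have -> : mx2 s 0 0 (- s) + (b1 / 2%:R) *: 1%:M = X.
  by rewrite scalar_mx2 scalemx_mx2 addmx_mx2 mulr1 mulr0 !addr0.
have -> : t *: mx2 (a / 2%:R) (Num.sqrt (4%:R - a ^+ 2) / 2%:R)
            (Num.sqrt (4%:R - a ^+ 2) / 2%:R) (- (a / 2%:R))
          + (c3 / 2%:R) *: 1%:M = Y.
  by rewrite scalar_mx2 !scalemx_mx2 addmx_mx2 mulr1 mulr0 !addr0 mulrN.
split=> [|mu hmin]; first exact: mu0_min.
have ht := minimal_type01 _ _ _ hnc (mu0_rep h) mu0_type hmin.
split=> //; have [hmu _] := hmin.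
have [A [B [muE AT BT]]] := type01_single _ _ hmu ht.
exists (Atom A B); split=> //.
have [hs hw] := model h; apply: orth_equiv_model => // w hw2.
have hw4 : (size w <= 4)%N by apply: leq_trans hw2 _.
rewrite -hw//; case: hmu => _ _ /(_ w hw4) ->.
by rewrite muE big_seq1 mul1r.
Qed.
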